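(* Let $R$ be a valuation ring, let $Z$ be the set of zero divisors of $R$ (a prime ideal), and let $E$ be an injective (respectively fp-injective) $R$-module. Then: (1) for each prime ideal $J$ of $R$ with $J\neq Z$, the localization $E_J$ is injective (respectively fp-injective); (2) $E_Z$ is injective (respectively fp-injective) if and only if $E$ is a flat $R$-module or $Z$ is a flat $R$-module.
   Context: All rings are commutative with identity and all modules are unital. A valuation ring is a ring whose ideals are totally ordered by inclusion. An $R$-module $E$ is fp-injective (absolutely pure) if $\mathrm{Ext}^1_R(F,E)=0$ for every finitely presented $R$-module $F$; equivalently, $E$ is a pure submodule of every module containing it. $E_J$ denotes the localization of $E$ at the prime ideal $J$. *)

(* Defs.v *)
From HB Require Import structures.
From mathcomp Require Import all_boot all_order all_algebra.
Set Implicit Arguments. Unset Strict Implicit. Unset Printing Implicit Defensive.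
Import GRing.Theory.
Local Open Scope ring_scope.

Section Defs.
Variable R : comNzRingType.

Definition islinear (A B : lmodType R) (f : A -> B) : Prop :=
  forall (a : R) (x y : A), f (a *: x + y) = a *: f x + f y.

Definition is_ideal (I : R -> Prop) : Prop :=
  [/\ I 0, (forall x y, I x -> I y -> I (x + y)) & (forall r x, I x -> I (r * x))].

Definition prime_ideal (J : R -> Prop) : Prop :=
  [/\ is_ideal J, ~ J 1 & (forall a b, J (a * b) -> J a \/ J b)].

Definition valuation_ring : Prop :=
  forall I1 I2 : R -> Prop, is_ideal I1 -> is_ideal I2 ->
    (forall x, I1 x -> I2 x) \/ (forall x, I2 x -> I1 x).

Definition zero_divisors : R -> Prop := fun r => exists2 x : R, x != 0 & r * x = 0.

Definition injective_module (E : lmodType R) : Prop :=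
  forall (A B : lmodType R) (f : A -> B) (g : A -> E),
    islinear f -> injective f -> islinear g ->
    exists h : B -> E, islinear h /\ forall a, h (f a) = g a.

Definition pure_embedding (E M : lmodType R) (i : E -> M) : Prop :=
  forall (m n : nat) (a : 'I_m -> 'I_n -> R) (e : 'I_m -> E),
    (exists x : 'I_n -> M, forall k, \sum_(j < n) a k j *: x j = i (e k)) ->
    exists y : 'I_n -> E, forall k, \sum_(j < n) a k j *: y j = e k.

(* fp-injective (absolutely pure): pure in every module containing it *)
Definition fp_injective_module (E : lmodType R) : Prop :=
  forall (M : lmodType R) (i : E -> M), islinear i -> injective i -> pure_embedding i.

(* flatness of the submodule S of V, via the equational criterion *)
Definition flat_sub (V : lmodType R) (S : V -> Prop) : Prop :=
  forall (n : nat) (r : 'I_n -> R) (x : 'I_n -> V),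
    (forall i, S (x i)) -> \sum_(i < n) r i *: x i = 0 ->
    exists (m : nat) (a : 'I_n -> 'I_m -> R) (y : 'I_m -> V),
      [/\ forall j, S (y j),
          forall i, x i = \sum_(j < m) a i j *: y j
        & forall j, \sum_(i < n) r i * a i j = 0].

Definition flat_module (V : lmodType R) : Prop := flat_sub (fun _ : V => True).

Definition flat_ideal (I : R -> Prop) : Prop := @flat_sub R^o I.

Definition is_localization (J : R -> Prop) (E L : lmodType R) (phi : E -> L) : Prop :=
  [/\ islinear phi,
      (forall s, ~ J s -> bijective (fun l : L => s *: l)),
      (forall l, exists e s, ~ J s /\ s *: l = phi e)
    & (forall e, phi e = 0 <-> exists2 t, ~ J t & t *: e = 0)].

End Defs.

(* Main.v *)
Require Import Defs.
From HB Require Import structures.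
From mathcomp Require Import all_boot all_order all_algebra.
From mathcomp Require Import ring.
From mathcomp Require Import boolp classical_sets.
Set Implicit Arguments. Unset Strict Implicit. Unset Printing Implicit Defensive.
Import GRing.Theory.
Local Open Scope ring_scope.

(** A module [E] over a valuation ring is fp-injective iff [(0 : r) e = 0]
    implies [e \in r E], since finite linear systems can be diagonalized, and it
    is injective iff every homomorphism from an ideal to [E] is a homothety.

    Both criteria pass from [E] to [E_J] as soon as the torsion witnesses are
    uniform: if [(0 : r) e] vanishes in [E_J], then [v (0 : r) e = 0] for a single
    [v] outside [J].  When some [s \in J] is regular, or [J = Z] is flat, every
    element of [(0 : r)] is a [J]-multiple of another one, and [J] kills the
    kernel of [E -> E_J]; when [s \in Z] lies outside [J], any [a] in
    [(0 : r) \ s (0 : r)] satisfies [s (0 : r) <= a R], so only the torsion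
    witness of [a e] is needed.  For injectivity, a homomorphism [g : I -> E_J]
    with [I = J I] is, up to a factor [v], lifted to [E]: an element [p b] with
    [p \in J] is sent to [v p y] for any lift [y] of [g b].  If [I <> J I], then
    [I] becomes principal after localization.

    Conversely, if [Z] is not flat, some [a \in (0 : r) \ Z (0 : r)] generates
    [(0 : r)] after localization at [Z]; all nonzero annihilators are then
    locally principal, and fp-injectivity of [E_Z] forces [E] to have no torsion
    by regular elements, whence [E] is flat. *)

(** * Elementary rules for linear maps *)

Section LinearMaps.
Variables (R : comNzRingType) (A B : lmodType R) (f : A -> B).
Hypothesis fl : islinear f.

Lemma islinear0 : f 0 = 0.
Proof. by have := fl 1 0 0; rewrite !scale1r addr0 -{1}[f 0]addr0 => /addrI/esym. Qed.

Lemma islinearD x y : f (x + y) = f x + f y.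
Proof. by have := fl 1 x y; rewrite !scale1r. Qed.

Lemma islinearZ a x : f (a *: x) = a *: f x.
Proof. by rewrite -[a *: x]addr0 fl islinear0 addr0. Qed.

Lemma islinearB x y : f (x - y) = f x - f y.
Proof. by rewrite islinearD -scaleN1r islinearZ scaleN1r. Qed.

Lemma islinear_sum n (F : 'I_n -> A) : f (\sum_(i < n) F i) = \sum_(i < n) f (F i).
Proof. by elim/big_rec2: _ => [|i y x _ <-]; rewrite ?islinear0 ?islinearD. Qed.

End LinearMaps.

(** * Quotient of a module by a submodule *)

Section QuotientModule.
Variables (R : nzRingType) (V : lmodType R) (N : V -> Prop).
Hypotheses (N0 : N 0) (NP : forall a x y, N x -> N y -> N (a *: x + y)).

Local Lemma N_opp x : N x -> N (- x).
Proof. by move=> Nx; rewrite -[- x]addr0 -scaleN1r; apply: NP. Qed.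

Local Lemma N_add x y : N x -> N y -> N (x + y).
Proof. by move=> Nx Ny; rewrite -[x]scale1r; apply: NP. Qed.

Local Lemma N_scale a x : N x -> N (a *: x).
Proof. by move=> Nx; rewrite -[a *: x]addr0; apply: NP. Qed.

Definition quot_rel : rel V := fun x y => `[< N (x - y) >].

Lemma quot_rel_equiv : equiv_class_of quot_rel.
Proof.
split=> [x|x y|y x z]; rewrite /quot_rel.
- by apply/asboolP; rewrite subrr.
- by apply/asboolP/asboolP => /N_opp; rewrite opprB.
- move=> /asboolP Nxy /asboolP Nyz; apply/asboolP.
  by have := N_add Nxy Nyz; rewrite addrA subrK.
Qed.

Canonical quot_equiv := EquivRelPack quot_rel_equiv.

Definition quot_mod := {eq_quot quot_equiv}%qT.
HB.instance Definition _ := Choice.on quot_mod.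

Definition quot_pi (x : V) : quot_mod := (\pi x)%qT.
Definition quot_repr (q : quot_mod) : V := repr q.

Lemma quot_reprK q : quot_pi (quot_repr q) = q.
Proof. exact: reprK. Qed.

Lemma quot_piP x y : quot_pi x = quot_pi y <-> N (x - y).
Proof.
split; first by move/eqquotP/asboolP.
by move=> Nxy; apply/eqquotP/asboolP.
Qed.

Lemma quot_repr_pi x : N (quot_repr (quot_pi x) - x).
Proof. by apply/quot_piP; rewrite quot_reprK. Qed.

Definition quot_add p q := quot_pi (quot_repr p + quot_repr q).
Definition quot_opp p := quot_pi (- quot_repr p).
Definition quot_scale a p := quot_pi (a *: quot_repr p).

Lemma quot_addE x y : quot_add (quot_pi x) (quot_pi y) = quot_pi (x + y).
Proof.
by apply/quot_piP; rewrite opprD addrACA; apply: N_add; apply: quot_repr_pi.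
Qed.

Lemma quot_oppE x : quot_opp (quot_pi x) = quot_pi (- x).
Proof. by apply/quot_piP; rewrite -opprD; apply/N_opp/quot_repr_pi. Qed.

Lemma quot_scaleE a x : quot_scale a (quot_pi x) = quot_pi (a *: x).
Proof. by apply/quot_piP; rewrite -scalerBr; apply/N_scale/quot_repr_pi. Qed.

Lemma quot_ind (P : quot_mod -> Prop) : (forall x, P (quot_pi x)) -> forall q, P q.
Proof. by move=> PP q; rewrite -(quot_reprK q). Qed.

Lemma quot_addA : associative quot_add.
Proof.
by elim/quot_ind=> x; elim/quot_ind=> y; elim/quot_ind=> z; rewrite !quot_addE addrA.
Qed.
Lemma quot_addC : commutative quot_add.
Proof. by elim/quot_ind=> x; elim/quot_ind=> y; rewrite !quot_addE addrC. Qed.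
Lemma quot_add0 : left_id (quot_pi 0) quot_add.
Proof. by elim/quot_ind=> x; rewrite !quot_addE add0r. Qed.
Lemma quot_addN : left_inverse (quot_pi 0) quot_opp quot_add.
Proof. by elim/quot_ind=> x; rewrite quot_oppE quot_addE addNr. Qed.

HB.instance Definition _ :=
  GRing.isZmodule.Build quot_mod quot_addA quot_addC quot_add0 quot_addN.

Lemma quot_scaleA a b v : quot_scale a (quot_scale b v) = quot_scale (a * b) v.
Proof. by elim/quot_ind: v => x; rewrite !quot_scaleE scalerA. Qed.
Lemma quot_scale1 : left_id 1 quot_scale.
Proof. by elim/quot_ind=> x; rewrite quot_scaleE scale1r. Qed.
Lemma quot_piD x y : quot_pi (x + y) = quot_pi x + quot_pi y.
Proof. exact: esym (quot_addE x y). Qed.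
Lemma quot_scaleDr : right_distributive quot_scale +%R.
Proof.
move=> a; elim/quot_ind=> x; elim/quot_ind=> y.
by rewrite -quot_piD !quot_scaleE scalerDr quot_piD.
Qed.
Lemma quot_scaleDl v : {morph quot_scale^~ v : a b / a + b}.
Proof.
by move=> a b; elim/quot_ind: v => x; rewrite !quot_scaleE scalerDl quot_piD.
Qed.

HB.instance Definition _ := GRing.Zmodule_isLmodule.Build R quot_mod
  quot_scaleA quot_scale1 quot_scaleDr quot_scaleDl.

Lemma quot_pi_linear a x y : quot_pi (a *: x + y) = a *: quot_pi x + quot_pi y.
Proof. by rewrite quot_piD -quot_scaleE. Qed.

End QuotientModule.

(** * Partial homomorphisms, pushouts and Baer's criterion *)

Section LinearRelations.
Variable R : comNzRingType.

(** The graph of a homomorphism from a submodule of [V] to [E]. The domain stays implicit, and the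
    last clause is single-valuedness. *)
Definition linrel (V E : lmodType R) (G : V -> E -> Prop) : Prop :=
  [/\ G 0 0,
      forall c a b x y, G a x -> G b y -> G (c *: a + b) (c *: x + y)
    & forall x, G 0 x -> x = 0].

(** Divide [E * V] by the pairs [(x, - a)] with [G a x]; as [G] is single-valued, [E] still
    embeds. *)
Lemma pushout (V E : lmodType R) (G : V -> E -> Prop) : linrel G ->
  exists (M : lmodType R) (i : E -> M) (j : V -> M),
    [/\ islinear i, injective i, islinear j & forall a x, G a x -> i x = j a].
Proof.
case=> G0 GP Gf.
pose N (p : (E * V)%type) := G (- p.2) p.1.
have N0 : N 0 by rewrite /N oppr0.
have NP c p q : N p -> N q -> N (c *: p + q).
  by rewrite /N /= opprD -scalerN; apply: GP.
exists (quot_mod N0 NP), (fun x => quot_pi N0 NP (x, 0)), (fun a => quot_pi N0 NP (0, a)).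
split=> [c x y|x y|c a b|a x Gax].
- by rewrite -quot_pi_linear; congr quot_pi; congr pair; rewrite /= scaler0 addr0.
- by move=> /quot_piP; rewrite /N /= subr0 oppr0 => /Gf/subr0_eq.
- by rewrite -quot_pi_linear; congr quot_pi; congr pair; rewrite /= scaler0 addr0.
- by apply/quot_piP; rewrite /N /= sub0r opprK subr0.
Qed.

Definition baer (E : lmodType R) : Prop :=
  forall G : R^o -> E -> Prop, linrel G -> exists l, forall a x, G a x -> x = a *: l.

(** The pushout retracts onto [E], and the retraction sends [j 1] to the multiplier. *)
Lemma injective_module_baer (E : lmodType R) : injective_module E -> baer E.
Proof.
move=> Einj G /pushout[M [i [j [il ii jl Gij]]]].
have [h [hl hi]] := Einj E M i id il ii (fun _ _ _ => erefl).
exists (h (j 1)) => a x Gax.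
rewrite -(hi x) (Gij _ _ Gax) -(islinearZ hl) -(islinearZ jl).
by congr (h (j _)); rewrite /= [RHS]mulr1.
Qed.

Lemma injective_module_fp (E : lmodType R) : injective_module E -> fp_injective_module E.
Proof.
move=> Einj M i il ii m n a e [x xP].
have [h [hl hi]] := Einj E M i id il ii (fun _ _ _ => erefl).
exists (h \o x) => k; rewrite -[RHS](hi) -xP (islinear_sum hl).
by apply: eq_bigr => j _; rewrite (islinearZ hl).
Qed.

(** The condition on [e] is what makes [r y = e] solvable in some extension of [E], so this is
    purity for one equation in one unknown. *)
Definition ann_div (E : lmodType R) : Prop :=
  forall (r : R) (e : E), (forall u, u * r = 0 -> u *: e = 0) -> exists y, e = r *: y.

Lemma fp_injective_ann_div (E : lmodType R) : fp_injective_module E -> ann_div E.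
Proof.
move=> Efp r e ann.
(* The homomorphism from [r R] to [E] sending [r] to [e]; in its pushout [j 1] solves [r y = e]. *)
pose G (a : R^o) (x : E) := exists c : R, a = c * r /\ x = c *: e.
have Glin : linrel G.
  split.
  - by exists 0; rewrite mul0r scale0r.
  - move=> c _ _ _ _ [p [-> ->]] [q [-> ->]]; exists (c * p + q); split.
      by rewrite mulrDl -mulrA.
    by rewrite scalerDl scalerA.
  - by move=> x [c [/esym c0 ->]]; apply: ann.
have [M [i [j [il ii jl Gij]]]] := pushout Glin.
have := Efp M i il ii 1%N 1%N (fun _ _ => r) (fun _ => e).
case.
  exists (fun _ => j 1) => _; rewrite big_ord1.
  rewrite (Gij r e); first by rewrite -(islinearZ jl); congr (j _); rewrite /= [LHS]mulr1.
  by exists 1; rewrite mul1r scale1r.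
by move=> y /(_ ord0); rewrite big_ord1 => <-; exists (y ord0).
Qed.

Lemma baer_injective_module (E : lmodType R) : baer E -> injective_module E.
Proof.
move=> Ebaer A B f g fl fi gl.
pose good (X : set (B * E)%type) :=
  (forall a, X (f a, g a)) /\ linrel (fun b x => X (b, x)).
pose P (X : set (B * E)%type) := (forall p, ~ X p) \/ good X.
have Pchain (F : set (set (B * E)%type)) : (F `<=` P)%classic ->
    total_on F subset -> P (\bigcup_(X in F) X)%classic.
  move=> FP Ftot.
  have [[p [X FX Xp]]|Fn] := pselect (exists p, (\bigcup_(X in F) X)%classic p);
    last by left=> p Fp; apply: Fn; exists p.
  have Fgood Y q : F Y -> Y q -> good Y.
    by move=> FY Yq; case: (FP _ FY) => // Yn; have := Yn q.
  have [Xb [X0 XP Xf]] := Fgood _ _ FX Xp.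
  right; split; first by move=> a; exists X => //; apply: Xb.
  split.
  - by exists X.
  - move=> c a b x y [Y FY Yax] [W FW Wby].
    have [YW|WY] := Ftot _ _ FY FW.
      have [_ [_ WP _]] := Fgood _ _ FW Wby.
      by exists W => //; apply: WP => //; apply: YW.
    have [_ [_ YP _]] := Fgood _ _ FY Yax.
    by exists Y => //; apply: YP => //; apply: WY.
  - move=> x [Y FY Y0x]; have [_ [_ _ Yf]] := Fgood _ _ FY Y0x.
    exact: Yf.
have [X [PX Xmax]] := Zorn_bigcup Pchain.
have good0 : good (fun p => exists a, p = (f a, g a)).
  split=> [a|]; first by exists a.
  split.
  - by exists 0; rewrite (islinear0 fl) (islinear0 gl).
  - by move=> c a b x y [a1 [-> ->]] [a2 [-> ->]]; exists (c *: a1 + a2); rewrite fl gl.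
  - move=> x [a [fa ->]]; rewrite -(islinear0 gl); congr g.
    by apply: fi; rewrite -fa (islinear0 fl).
have {PX} [Xb [X0 XP Xf]] : good X.
  case: PX => // Xn; exfalso; apply: (Xmax _ _ (or_intror good0)).
  split=> [p /Xn//|sub]; apply: (Xn (f 0, g 0)); apply: sub; by exists 0.
have XZ c a x : X (a, x) -> X (c *: a, c *: x).
  by move=> Xax; have := XP c _ _ _ _ Xax X0; rewrite !addr0.
have XB a b x y : X (a, x) -> X (b, y) -> X (a - b, x - y).
  by move=> Xax Xby; have := XP (-1) _ _ _ _ Xby Xax; rewrite !scaleN1r ![- _ + _]addrC.
have Xtot b : exists x, X (b, x).
  apply: contrapT => Xnb.
  (* [X] induces a homomorphism on the ideal of the [r] with [r b] in its domain; its multiplier [l]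
     is a compatible value at [b]. *)
  have [l lP] : exists l, forall (r : R^o) x, X (r *: b, x) -> x = r *: l.
    apply: Ebaer; split.
    - by rewrite scale0r.
    - by move=> c a d x y Xa Xd; rewrite scalerDl -scalerA; apply: XP.
    - by move=> x; rewrite scale0r; apply: Xf.
  pose Y (p : (B * E)%type) := exists r q, X q /\ p = (q.1 + r *: b, q.2 + r *: l).
  apply: (Xmax Y); first split.
  - by move=> [a x] Xax; exists 0, (a, x); rewrite !scale0r !addr0.
  - move=> sub; apply: Xnb; exists l; apply: sub.
    by exists 1, (0, 0); rewrite /= !scale1r !add0r.
  - right; split=> [a|].
      by exists 0, (f a, g a); rewrite !scale0r !addr0.
    split.
    - by exists 0, (0, 0); rewrite /= !scale0r !addr0.
    - move=> c a d x y [r1 [[q1 z1] [Xq1 [-> ->]]]] [r2 [[q2 z2] [Xq2 [-> ->]]]] /=.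
      exists (c * r1 + r2), (c *: q1 + q2, c *: z1 + z2); split; first exact: XP.
      by congr pair; rewrite /= scalerDr scalerDl scalerA addrACA.
    - move=> x [r [[q z] [Xq [/esym/eqP]]]] /=.
      rewrite addr_eq0 => /eqP qE ->.
      have /lP -> : X ((- r) *: b, z) by rewrite scaleNr -qE.
      by rewrite scaleNr addNr.
have [h hP] := choice Xtot.
have hu b x : X (b, x) -> h b = x.
  by move=> Xbx; apply/subr0_eq/Xf; have := XB _ _ _ _ (hP b) Xbx; rewrite subrr.
by exists h; split=> [c x y|a]; apply: hu => //; apply: XP.
Qed.

End LinearRelations.

(** * Divisibility, linear systems and flatness over a valuation ring *)

Section ValuationRing.
Variables (R : comNzRingType) (hR : valuation_ring R).
Local Notation Z := (@zero_divisors R).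

Lemma dvdr_total (a b : R) : (exists c, b = c * a) \/ (exists c, a = c * b).
Proof.
have principal (x : R) : is_ideal (fun y => exists c, y = c * x).
  split; first by exists 0; rewrite mul0r.
    by move=> _ _ [c ->] [d ->]; exists (c + d); rewrite mulrDl.
  by move=> r _ [c ->]; exists (r * c); rewrite mulrA.
have [sub|sub] := hR (principal a) (principal b); [right|left]; apply: sub;
  by exists 1; rewrite mul1r.
Qed.

Lemma finite_dvdr (T : finType) (t0 : T) (f : T -> R) :
  exists t, forall t', exists c, f t' = c * f t.
Proof.
suff [t tP] : exists t, forall t', t' \in enum T -> exists c, f t' = c * f t.
  by exists t => t'; apply: tP; rewrite mem_enum.
elim: (enum T) => [|x s [t tP]]; first by exists t0.
have [[c fc]|[c fc]] := dvdr_total (f t) (f x).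
  by exists t => t'; rewrite inE => /predU1P[->|/tP//]; exists c.
exists x => t'; rewrite inE => /predU1P[->|/tP[d ->]]; first by exists 1; rewrite mul1r.
by exists (d * c); rewrite fc mulrA.
Qed.

(* Gaussian elimination: the pivot is an entry dividing all the others, so
   every step splits off a single equation [p X = e]. *)
Lemma ann_div_solve (E M : lmodType R) (i : E -> M) : ann_div E ->
    islinear i -> injective i ->
  forall (m n : nat) (S : {set 'I_n}) (a : 'I_m -> 'I_n -> R) (e : 'I_m -> E),
    (exists x : 'I_n -> M, forall k, \sum_(j in S) a k j *: x j = i (e k)) ->
    exists y : 'I_n -> E, forall k, \sum_(j in S) a k j *: y j = e k.
Proof.
move=> Ediv il ii m n S; move: {2}#|S| (leqnn #|S|) => s.
elim: s m S => [|s IHs] m S.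
  rewrite leqn0 cards_eq0 => /eqP-> a e [x xP].
  exists (fun _ => 0) => k; apply: ii.
  by rewrite -xP !big_set0 (islinear0 il).
move=> leS a e [x xP].
have [S0|[j1 Sj1]] := set_0Vmem S.
  exists (fun _ => 0) => k; apply: ii.
  by rewrite -xP S0 !big_set0 (islinear0 il).
case: m a e xP => [|m] a e xP; first by exists (fun _ => 0) => -[].
pose T := ('I_m.+1 * {j | j \in S})%type.
have [[k0 [j0 Sj0]] piv] := @finite_dvdr T (ord0, exist _ j1 Sj1) (fun t => a t.1 (val t.2)).
set p := a k0 j0.
have {piv} [b bP] : exists b : 'I_m.+1 -> 'I_n -> R,
    forall k j, j \in S -> a k j = b k j * p.
  have [b bP] := choice piv.
  exists (fun k j => if insub j is Some u then b (k, u) else 0) => k j Sj.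
  by rewrite insubT; apply: (bP (k, exist _ j Sj)).
(* With zero divisors, [b k0 j0 * p = p] does not force [b k0 j0 = 1], so the quotient at the pivot
   is reset to 1. *)
pose c k j := if (k == k0) && (j == j0) then 1 else b k j.
have cP k j : j \in S -> a k j = c k j * p.
  by move=> Sj; rewrite /c; case: ifP => [/andP[/eqP-> /eqP->]|_]; [rewrite mul1r | apply: bP].
have c00 : c k0 j0 = 1 by rewrite /c !eqxx.
pose S' := S :\ j0.
have split_sum (N : lmodType R) (k : 'I_m.+1) (z : 'I_n -> N) :
    \sum_(j in S) a k j *: z j = p *: (c k j0 *: z j0 + \sum_(j in S') c k j *: z j).
  rewrite (big_setD1 j0 Sj0) /= scalerDr scaler_sumr scalerA mulrC -cP //.
  congr (_ + _); apply: eq_bigr => j; rewrite 2!inE => /andP[_ Sj].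
  by rewrite scalerA mulrC -cP.
pose X := \sum_(j in S) c k0 j *: x j.
have XE : X = x j0 + \sum_(j in S') c k0 j *: x j.
  by rewrite /X (big_setD1 j0 Sj0) /= c00 scale1r.
have pX : p *: X = i (e k0) by rewrite -xP split_sum c00 scale1r -XE.
have [Y pY] : exists Y, e k0 = p *: Y.
  apply: Ediv => u up0; apply: ii.
  by rewrite (islinearZ il) -pX scalerA up0 scale0r (islinear0 il).
(* Row [k] minus [c k j0] times row [k0]: column [j0] vanishes, and row [k0] is kept as [0 = 0]. *)
pose a' k j := p * (c k j - c k j0 * c k0 j).
have a'_sum (N : lmodType R) (k : 'I_m.+1) (z : 'I_n -> N) :
    \sum_(j in S') a' k j *: z j =
    p *: (\sum_(j in S') c k j *: z j - c k j0 *: \sum_(j in S') c k0 j *: z j).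
  rewrite scaler_sumr -sumrB scaler_sumr; apply: eq_bigr => j _.
  by rewrite -scalerA scalerBl scalerA.
have [||y yP] := IHs _ S' _ a' (fun k => e k - c k j0 *: e k0).
- by rewrite -ltnS; apply: leq_trans leS; rewrite (cardsD1 j0 S) Sj0.
- exists x => k; rewrite a'_sum (islinearB il) (islinearZ il) -xP -pX split_sum XE.
  rewrite scalerA [c k j0 * p]mulrC -scalerA -scalerBr; congr (p *: _).
  by rewrite scalerDr opprD addrACA subrr add0r.
pose w := \sum_(j in S') c k0 j *: y j.
(* The value at [j0] is chosen so that the pivot row, divided by [p], sums to [Y]. *)
exists (fun j => if j == j0 then Y - w else y j) => k.
rewrite split_sum eqxx.
rewrite [X in _ + X](eq_bigr (fun j => c k j *: y j)); last first.
  by move=> j; rewrite 2!inE => /andP[/negPf-> _].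
have := yP k; rewrite a'_sum pY => /esym/eqP; rewrite subr_eq => /eqP ->.
rewrite scalerA [c k j0 * p]mulrC -scalerA -scalerDr; congr (p *: _).
by rewrite scalerBr -/w [RHS]addrC -addrA [- _ + _]addrC.
Qed.

Lemma ann_div_fp_injective (E : lmodType R) : ann_div E -> fp_injective_module E.
Proof.
move=> Ediv M i il ii m n a e [x xP].
have [|y yP] := ann_div_solve Ediv il ii (S := [set: 'I_n]) (a := a) (e := e).
  by exists x => k; rewrite -xP; apply: eq_bigl => j; rewrite inE.
by exists y => k; rewrite -yP; apply: eq_bigl => j; rewrite inE.
Qed.

(** A coefficient dividing all the others turns a relation into [r x = 0] for a single [x]; in the
    other direction, the coefficients obtained from a one-term relation are all multiples of one of
    them. *)
Lemma flat_subP (V : lmodType R) (S : V -> Prop) :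
    S 0 -> (forall a x y, S x -> S y -> S (a *: x + y)) ->
  flat_sub S <-> forall r x, S x -> r *: x = 0 ->
                   exists al y, [/\ S y, r * al = 0 & x = al *: y].
Proof.
move=> S0 SP; have Ssum n (a : 'I_n -> R) (y : 'I_n -> V) :
    (forall j, S (y j)) -> S (\sum_j a j *: y j).
  by move=> Sy; elim/big_rec: _ => // i x _ Sx; apply: SP.
split=> [Sflat r x Sx rx|Sdiv].
  have [||m [a [y [Sy xE aE]]]] := Sflat 1%N (fun=> r) (fun=> x) => //.
    by rewrite big_ord1.
  case: m a y Sy xE aE => [|m] a y Sy xE aE.
    by exists 0, 0; rewrite mulr0 scale0r (xE ord0) big_ord0.
  have [j0 j0P] := finite_dvdr (ord0 : 'I_m.+1) (a ord0).
  have [b bP] := choice j0P.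
  exists (a ord0 j0), (\sum_j b j *: y j); split; first exact: Ssum.
    by have := aE j0; rewrite big_ord1.
  rewrite (xE ord0) scaler_sumr; apply: eq_bigr => j _.
  by rewrite bP scalerA mulrC.
case=> [|n] r x Sx rx.
  by exists 0%N, (fun _ _ => 0), (fun _ => 0); split=> // -[].
have [i0 i0P] := finite_dvdr (ord0 : 'I_n.+1) r.
have [c cP] := choice i0P.
pose d j := if j == i0 then 1 else c j.
have dP j : r j = d j * r i0.
  by rewrite /d; case: eqP => [->|_]; rewrite ?mul1r -?cP.
have [||al [y [Sy ral yE]]] := Sdiv (r i0) (\sum_j d j *: x j).
- exact: Ssum.
- by rewrite scaler_sumr -[RHS]rx; apply: eq_bigr => j _; rewrite scalerA mulrC -dP.
(* The new generators are the [x j] with [x i0] replaced by [y], since [x i0] is [al y] minus the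
   other [d j x j]. *)
exists n.+1, (fun i j => if i == i0 then if j == i0 then al else - d j
                         else (i == j)%:R),
  (fun j => if j == i0 then y else x j).
split=> [j|i|j]; first by case: ifP.
- have [->|ii0] := eqVneq i i0.
    rewrite (bigD1 i0) //= !eqxx -yE (bigD1 i0) //= {1}/d eqxx scale1r -addrA.
    rewrite -big_split big1 /= ?addr0 // => j /negPf->.
    by rewrite scaleNr addrN.
  rewrite (bigD1 i) //= eqxx (negPf ii0) scale1r big1 ?addr0 // => j.
  by rewrite eq_sym => /negPf->; rewrite scale0r.
- rewrite (bigD1 i0) //= eqxx.
  have [->|ji0] := eqVneq j i0.
    by rewrite ral add0r big1 // => i ii0; rewrite (negPf ii0) mulr0.
  rewrite (bigD1 j) //= (negPf ji0) eqxx big1 => [|i /andP[/negPf-> /negPf->]].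
    by rewrite mulr1 addr0 mulrN (dP j) mulrC addNr.
  by rewrite mulr0.
Qed.

Lemma flat_moduleP (V : lmodType R) : flat_module V <->
  forall (r : R) (x : V), r *: x = 0 -> exists al y, r * al = 0 /\ x = al *: y.
Proof.
rewrite /flat_module flat_subP //; split=> H r x.
  by move=> rx; have [al [y [_ ral xE]]] := H r x I rx; exists al, y.
by move=> _ /H[al [y [ral xE]]]; exists al, y.
Qed.

Lemma zero_divisorP r x : r * x = 0 -> ~ Z r -> x = 0.
Proof. by move=> rx Zr; apply: contrapT => /eqP x0; apply: Zr; exists x. Qed.

Lemma zero_divisor_mul r x : x <> 0 -> r * x = 0 -> Z r.
Proof. by move=> /eqP x0 rx; exists x. Qed.

Lemma prime_ideal_zero_divisors : prime_ideal Z.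
Proof.
have ZM r x : Z x -> Z (r * x) by case=> y y0 xy; exists y; rewrite // -mulrA xy mulr0.
split; first split=> //.
- by exists 1; rewrite ?oner_neq0 // mul0r.
- move=> x y Zx Zy; have [[c ->]|[c ->]] := dvdr_total x y.
    by rewrite -[X in X + _]mul1r -mulrDl; apply: ZM.
  by rewrite -[X in _ + X]mul1r -mulrDl; apply: ZM.
- by case=> x /eqP x0; rewrite mul1r.
- move=> a b [x x0 abx]; have [bx|bx] := eqVneq (b * x) 0; first by right; exists x.
  by left; exists (b * x); rewrite // mulrA.
Qed.

(** In terms of annihilators this is [(0 : r) = Z (0 : r)]; membership of [a] in [Z] is automatic
    because [r] is nonzero. *)
Lemma flat_idealP : flat_ideal Z <-> forall r a, r <> 0 -> a * r = 0 ->
  exists y al, [/\ Z y, al * r = 0 & a = y * al].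
Proof.
have [[Z0 ZD ZM] _ _] := prime_ideal_zero_divisors.
rewrite /flat_ideal flat_subP //; last by move=> a x y Zx Zy; apply: ZD => //; apply: ZM.
split=> [H r a r0 ar|H r x Zx rx].
  have [|al [y [Zy ral aE]]] := H r a (zero_divisor_mul r0 ar); first by rewrite -[RHS]ar mulrC.
  by exists y, al; rewrite mulrC; split=> //; rewrite aE mulrC.
have [->|/eqP r0] := eqVneq r 0.
  by exists 1, x; rewrite mul0r scale1r.
have [|y [al [Zy alr xE]]] := H r x r0; first by rewrite -[RHS]rx mulrC.
by exists al, y; split=> //; [rewrite mulrC | rewrite xE mulrC].
Qed.

(** * Passage of both criteria from a module to its localization *)

Section Localization.
Variables (J : R -> Prop) (Jp : prime_ideal J).
Variables (E L : lmodType R) (phi : E -> L) (loc : is_localization J phi).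

Let phil : islinear phi. Proof. by case: loc. Qed.

Lemma prime_ideal_dvdr p t : J p -> ~ J t -> exists2 q, J q & p = q * t.
Proof.
have [[_ _ JM] _ Jprime] := Jp; move=> Jpp Jt.
have [[q pE]|[c tE]] := dvdr_total t p; last by case: Jt; rewrite tE; apply: JM.
by exists q => //; move: Jpp; rewrite pE => /Jprime[].
Qed.

Lemma prime_ideal_nmul a b : ~ J a -> ~ J b -> ~ J (a * b).
Proof. by case: Jp => _ _ Jprime Ja Jb /Jprime[]. Qed.

Lemma loc_div s (l : L) : ~ J s -> exists l', l = s *: l'.
Proof. by case: loc => _ bij _ _ /bij[g _ gK]; exists (g l); rewrite gK. Qed.

Lemma loc_inj s (l l' : L) : ~ J s -> s *: l = s *: l' -> l = l'.
Proof. by case: loc => _ bij _ _ /bij/bij_inj; apply. Qed.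

Lemma loc_eq0 s (l : L) : ~ J s -> s *: l = 0 -> l = 0.
Proof. by move=> Js sl; apply: (loc_inj Js); rewrite sl scaler0. Qed.

Lemma loc_ker e : phi e = 0 -> exists2 t, ~ J t & t *: e = 0.
Proof. by case: loc => _ _ _ /(_ e)[]. Qed.

(** The torsion witness [t] of [e] lies outside [J], hence divides every element of [J]. *)
Lemma loc_ker_ideal p e : J p -> phi e = 0 -> p *: e = 0.
Proof.
move=> Jpp /loc_ker[t Jt te]; have [q _ ->] := prime_ideal_dvdr Jpp Jt.
by rewrite -scalerA te scaler0.
Qed.

(* The point is that [v] does not depend on [u]. *)
Definition uniform_ann : Prop := forall (r : R) (e : E), J r -> r <> 0 ->
  (forall u, u * r = 0 -> phi (u *: e) = 0) ->
  exists2 v, ~ J v & forall u, u * r = 0 -> v *: (u *: e) = 0.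

Lemma uniform_ann_proper s : Z s -> ~ J s -> uniform_ann.
Proof.
have [[_ _ JM] _ Jprime] := Jp.
move=> [y /eqP y0 sy] Js r e Jr r0 ann.
have [r' Jr' rE] := prime_ideal_dvdr Jr Js.
(* Suppose [(0 : r) = s (0 : r)], with [r = r' s] and [s y = 0]. If [y = q r'], then [q] kills [r],
   so [q = s b] with [b r = 0] and [y = b r = 0]; if [r' = q y], then [r = 0]. *)
have [a [ar aP]] : exists a, a * r = 0 /\ forall b, b * r = 0 -> a <> s * b.
  apply: contrapT => nA.
  have sA a : a * r = 0 -> exists2 b, b * r = 0 & a = s * b.
    by move=> ar; apply: contrapT => nb; apply: nA; exists a; split=> // b br ab; apply: nb; exists b.
  have [[q yE]|[q r'E]] := dvdr_total r' y.
    have [|b br qE] := sA q; first by rewrite rE mulrA -yE mulrC.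
    by apply: y0; rewrite yE qE [s * b]mulrC -mulrA [s * r']mulrC -rE.
  by apply: r0; rewrite rE r'E -mulrA [y * s]mulrC sy mulr0.
have sAa b : b * r = 0 -> exists c, s * b = c * a.
  move=> br; have [//|[c aE]] := dvdr_total a (s * b).
  by case: (aP (c * b)); [rewrite -mulrA br mulr0 | rewrite aE mulrCA].
have [t Jt tae] := loc_ker (ann a ar).
exists (t * s); first exact: prime_ideal_nmul.
move=> u /sAa[c su].
by rewrite scalerA -mulrA su mulrCA -!scalerA tae scaler0.
Qed.

Lemma uniform_ann_flat :
    (forall r a, r <> 0 -> a * r = 0 -> exists y al, [/\ J y, al * r = 0 & a = y * al]) ->
  uniform_ann.
Proof.
case: (Jp) => _ J1 _ flatJ r e _ r0 ann; exists 1 => // u /(flatJ _ _ r0)[y [al [Jy /ann alr ->]]].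
by rewrite scale1r -scalerA; apply: loc_ker_ideal.
Qed.

(** A regular [s] in [J] divides every [a] in [(0 : r)], as otherwise [s r = 0]; the quotient again
    kills [r], by regularity. *)
Lemma uniform_ann_above s : J s -> ~ Z s -> uniform_ann.
Proof.
move=> Js Zs; apply: uniform_ann_flat => r a r0 ar.
have [[q aE]|[c sE]] := dvdr_total s a; last first.
  by case: Zs; apply: (zero_divisor_mul r0); rewrite sE -mulrA ar mulr0.
exists s, q; split=> //; last by rewrite mulrC.
by apply: zero_divisorP Zs; rewrite mulrCA mulrA -aE.
Qed.

Lemma uniform_ann_inj : (forall e, phi e = 0 -> e = 0) -> uniform_ann.
Proof.
move=> inj r e _ _ ann; case: (Jp) => _ J1 _.
by exists 1 => // u /ann/inj; rewrite scale1r.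
Qed.

(** Write [l = e / s]. The uniform [v] makes the criterion in [E] apply to [v e = r y], and
    [y / (v s)] is the answer. For [r] outside [J], division is built in. *)
Lemma loc_ann_div : ann_div E -> uniform_ann -> ann_div L.
Proof.
move=> Ediv unif r l ann.
have [r0|/eqP r0] := eqVneq r 0.
  by exists 0; rewrite scaler0 -[l]scale1r; apply: ann; rewrite r0 mulr0.
have [Jr|/loc_div] := pselect (J r); last exact.
have [_ _ surj _] := loc; have [e [s [Js sl]]] := surj l.
have [|v Jv vP] := unif r e Jr r0.
  by move=> u /ann ul; rewrite (islinearZ phil) -sl scalerA mulrC -scalerA ul scaler0.
have [y yE] : exists y, v *: e = r *: y.
  by apply: Ediv => u /vP; rewrite !scalerA mulrC.
have [y' y'E] := loc_div (phi y) (prime_ideal_nmul Jv Js).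
exists y'; apply: (loc_inj (prime_ideal_nmul Jv Js)).
by rewrite -scalerA sl -(islinearZ phil) yE (islinearZ phil) y'E !scalerA mulrC.
Qed.

(* [G] is the graph of a homomorphism from an ideal to [L].  The lift to [E] is
   only defined through elements [b] dividing a fixed [a0] with [(0 : a0)]
   contained in [J], because [v] is obtained from [a0]. *)
Lemma loc_baer : baer E -> ann_div L -> uniform_ann -> baer L.
Proof.
move=> Ebaer Ldiv unif G [G0 GP Gf].
have [[J0 JD JM] J1 Jprime] := Jp.
have GZ c a l : G a l -> G (c * a) (c *: l).
  by move=> Gal; have := GP c _ _ _ _ Gal G0; rewrite !addr0.
have Gu a l l' : G a l -> G a l' -> l = l'.
  move=> Gal Gal'; apply/subr0_eq/Gf.
  have := GP (-1) _ _ _ _ Gal' Gal; rewrite !scaleN1r !(addrC (- _)).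
  by rewrite [X in G X]subrr.
have Gann a l u : G a l -> u * a = 0 -> u *: l = 0.
  by move=> Gal ua; apply: Gf; rewrite -ua; apply: GZ.
have [[a [l [Gal aP]]]|allJ] :=
    pselect (exists a l, G a l /\ forall p b m, J p -> G b m -> a <> p * b).
  (* Here [a] lies in [I] but not in [J I]: any [b] in [I] either is a multiple of [a] or divides it
     with a quotient outside [J], invertible on [L]. *)
  have [l' lE] : exists l', l = a *: l' by apply: Ldiv => u; apply: Gann.
  exists l' => b m Gbm; have [[c aE]|[d bE]] := dvdr_total b a.
    have Jc : ~ J c by move=> Jc; apply: (aP c b m).
    apply: (loc_inj Jc); rewrite scalerA -aE -lE.
    by apply: (@Gu a); rewrite // aE; apply: GZ.
  by apply: (@Gu b) => //; rewrite bE -scalerA -lE; apply: GZ.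
have {}allJ a l : G a l -> exists p b m, [/\ J p, G b m & a = p * b].
  move=> Gal; apply: contrapT => nH; apply: allJ; exists a, l; split=> // p b m Jpp Gbm aE.
  by apply: nH; exists p, b, m.
have GJ a l : G a l -> J a.
  by case/allJ => p [b [m [Jpp _ ->]]]; rewrite mulrC; apply: JM.
(* Values need no denominators: in [a = p b] the factor [p] in [J] absorbs the denominator of the
   value at [b]. *)
have Gim a l : G a l -> exists x, phi x = l.
  move=> Gal; have [p [b [m [Jpp Gbm aE]]]] := allJ _ _ Gal.
  have [_ _ surj _] := loc; have [e [s [Js sm]]] := surj m.
  have [q _ pE] := prime_ideal_dvdr Jpp Js.
  exists (q *: e); rewrite (islinearZ phil) -sm scalerA -pE.
  by apply: (@Gu a) => //; rewrite aE; apply: GZ.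
(* Without such an [a0], each element of the ideal is killed from outside [J], so the homomorphism
   is zero. *)
have [[a0 [l0 [Ga0 a00 a0J]]]|noa0] := pselect (exists a0 l0,
    [/\ G a0 l0, a0 <> 0 & forall u, u * a0 = 0 -> J u]); last first.
  exists 0 => a l Gal; rewrite scaler0.
  have [a0|/eqP a0] := eqVneq a 0; first by apply: Gf; rewrite -a0.
  have [u Ju ua] : exists2 u, ~ J u & u * a = 0.
    apply: contrapT => nu; apply: noa0; exists a, l; split=> // u ua.
    by apply: contrapT => Ju; apply: nu; exists u.
  exact: loc_eq0 Ju (Gann _ _ _ Gal ua).
have [x0 x0E] := Gim _ _ Ga0.
have [|v Jv vP] := unif a0 x0 (GJ _ _ Ga0) a00.
  by move=> u ua0; rewrite (islinearZ phil) x0E; apply: Gann Ga0 ua0.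
(* The [v] chosen for [a0] serves every divisor [a] of [a0]: [u = d c] with [d] killing [a0], so [d]
   is in [J] and kills the kernel element [c x - x0]. *)
have vann a l c x u : G a l -> a0 = c * a -> phi x = l -> u * a = 0 ->
    v *: (u *: x) = 0.
  move=> Gal a0E xE ua.
  have [[d uE]|[d cE]] := dvdr_total c u; last first.
    by case: a00; rewrite a0E cE -mulrA ua mulr0.
  have da0 : d * a0 = 0 by rewrite a0E mulrA -uE.
  have -> : u *: x = d *: (c *: x - x0) + d *: x0.
    by rewrite scalerBr subrK scalerA uE.
  rewrite scalerDr vP // addr0 (loc_ker_ideal (a0J _ da0)) ?scaler0 //.
  rewrite (islinearB phil) (islinearZ phil) x0E xE; apply/eqP; rewrite subr_eq0; apply/eqP.
  by apply: (@Gu a0) => //; rewrite a0E; apply: GZ.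
(* Independence of factorization and lift: [q] in [J] kills the difference of two lifts, and [v]
   absorbs the change of coefficient by [vann]. *)
have vwd a l c x b m y p q d : G a l -> a0 = c * a -> phi x = l ->
    G b m -> phi y = m -> J q -> b = d * a -> p * a = q * b ->
    v *: (q *: y) = v *: (p *: x).
  move=> Gal a0E xE Gbm yE Jq bE pq.
  have -> : p *: x = (p - q * d) *: x + q *: (d *: x).
    by rewrite scalerBl scalerA subrK.
  rewrite [in RHS]scalerDr (vann a l c) ?add0r //; last first.
    by rewrite mulrBl pq bE mulrA subrr.
  apply/subr0_eq; rewrite -2!scalerBr (loc_ker_ideal Jq) ?scaler0 //.
  rewrite (islinearB phil) (islinearZ phil) yE xE; apply/eqP; rewrite subr_eq0; apply/eqP.
  by apply: (@Gu b) => //; rewrite bE; apply: GZ.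
pose H (a : R^o) (z : E) := exists p b c x, [/\ J p, G b (phi x), a0 = c * b,
  a = p * b & z = v *: (p *: x)].
have Hlin : linrel H.
  split.
  - exists 0, a0, 1, x0; split=> //; first by rewrite x0E.
    + by rewrite mul1r.
    + by rewrite mul0r.
    + by rewrite scale0r scaler0.
  - move=> k _ _ _ _ [p [b [c [x [Jpp Gb a0b -> ->]]]]] [q [b' [c' [x' [Jq Gb' a0b' -> ->]]]]].
    have [[d b'E]|[d bE]] := dvdr_total b b'.
      exists (k * p + q * d), b, c, x; split=> //.
      + by apply: JD; [apply: JM | rewrite mulrC; apply: JM].
      + by rewrite b'E mulrDl -!mulrA.
      + rewrite (vwd b (phi x) c x b' (phi x') x' (q * d) q d) ?b'E ?mulrA //; last by rewrite -b'E.
        by rewrite scalerDl scalerDr -!scalerA; congr (_ + _); rewrite !scalerA; congr (_ *: _); ring.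
    exists (k * (p * d) + q), b', c', x'; split=> //.
    + by apply: JD; rewrite // [p * d]mulrC mulrA; apply: JM.
    + by rewrite bE mulrDl -!mulrA.
    + rewrite (vwd b' (phi x') c' x' b (phi x) x (p * d) p d) ?bE ?mulrA //; last by rewrite -bE.
      by rewrite scalerDl scalerDr -!scalerA; congr (_ + _); rewrite !scalerA; congr (_ *: _); ring.
  - move=> z [p [b [c [x [Jpp Gb a0b /esym pb ->]]]]].
    rewrite (vwd b (phi x) c x b (phi x) x 0 p 1) ?mul1r ?mul0r //.
    by rewrite scale0r scaler0.
have [e eP] := Ebaer H Hlin.
have [l'' l''E] := loc_div (phi e) Jv.
exists l'' => a l Gal; apply: (loc_inj Jv).
have [z [Haz zE]] : exists z, H a z /\ phi z = v *: l.
  have [p [b [m [Jpp Gbm aE]]]] := allJ _ _ Gal; have [y yE] := Gim _ _ Gbm.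
  have lE : p *: m = l by apply: (@Gu a) => //; rewrite aE; apply: GZ.
  (* If [b] does not divide [a0], it is a multiple [d a0], and [a] is factored through [a0] with the
     lift [x0] instead. *)
  have [[c a0E]|[d bE]] := dvdr_total b a0.
    exists (v *: (p *: y)); rewrite !(islinearZ phil) yE lE; split=> //.
    by exists p, b, c, y; rewrite yE.
  have mE : d *: l0 = m by apply: (@Gu b) => //; rewrite bE; apply: GZ.
  exists (v *: ((p * d) *: x0)); split; last by rewrite !(islinearZ phil) x0E -scalerA mE lE.
  exists (p * d), a0, 1, x0; split=> //.
  - by rewrite mulrC; apply: JM.
  - by rewrite x0E.
  - by rewrite mul1r.
  - by rewrite aE bE mulrA.
by rewrite -zE (eP _ _ Haz) (islinearZ phil) l''E !scalerA mulrC.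
Qed.

End Localization.

(** * The converse at [Z] when [Z] is not flat *)

Section ZeroDivisorsNotFlat.
Variables (E L : lmodType R) (phi : E -> L) (loc : is_localization Z phi).
Hypotheses (Ediv : ann_div E) (Ldiv : ann_div L).
Variables (r a : R) (r0 : r <> 0) (ar : a * r = 0).
Hypothesis amin : forall y al, Z y -> al * r = 0 -> a <> y * al.

Let Zp := prime_ideal_zero_divisors.
Let Z1 : ~ Z 1. Proof. by case: Zp. Qed.
Let ZM x y : Z y -> Z (x * y). Proof. by case: Zp => -[_ _ ZM] _ _; apply: ZM. Qed.
Let Z0 : Z 0. Proof. by case: Zp => -[]. Qed.

Let a0 : a <> 0.
Proof. by move=> aE; apply: (amin (y := 0) (al := 0) Z0); rewrite mul0r. Qed.

(* [(0 : r)] localized at [Z] is generated by [a]. *)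
Lemma annr_loc al : al * r = 0 -> exists2 c, ~ Z c & exists d, c * al = d * a.
Proof.
move=> alr; have [[c aE]|[d alE]] := dvdr_total al a.
  exists c; last by exists 1; rewrite mul1r.
  by move=> Zc; apply: (amin Zc alr).
by exists 1 => //; exists d; rewrite mul1r.
Qed.

(* [(0 : a)] localized at [Z] is generated by [r]. *)
Lemma anna_loc u : u * a = 0 -> exists2 c, ~ Z c & exists d, c * u = d * r.
Proof.
move=> ua; have [[d uE]|[v rE]] := dvdr_total r u.
  by exists 1 => //; exists d; rewrite mul1r.
exists v; last by exists 1; rewrite mul1r.
move=> Zv; have [[q aE]|[c vE]] := dvdr_total v a.
  apply: (amin (y := v) (al := q)) => //; last by rewrite mulrC.
  by rewrite rE mulrA -aE mulrC.
by apply: r0; rewrite rE vE -mulrA [a * u]mulrC ua mulr0.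
Qed.

(** Elements of [(0 : a)] are multiples of [t], so [x = a y]. As [a] locally generates [(0 : r)] and
    [phi (a y) = 0], [phi y] is divisible by [r]. Clearing denominators by a regular factor of [a]
    gives [a y = q t' r e] with [q r = 0]. *)
Lemma zero_divisors_torsion_free t (x : E) : ~ Z t -> t *: x = 0 -> x = 0.
Proof.
move=> Zt tx.
have [y xE] : exists y, x = a *: y.
  apply: Ediv => u ua.
  have [q _ ->] := prime_ideal_dvdr Zp (zero_divisor_mul a0 ua) Zt.
  by rewrite -scalerA tx scaler0.
have phil : islinear phi by case: loc.
have phi0 : phi (a *: y) = 0.
  by apply: (loc_eq0 loc Zt); rewrite -(islinearZ phil) -xE tx (islinear0 phil).
have [l yl] : exists l, phi y = r *: l.
  apply: Ldiv => al /annr_loc[c Zc [d cal]]; apply: (loc_eq0 loc Zc).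
  by rewrite scalerA cal -scalerA -(islinearZ phil) phi0 scaler0.
have [_ _ surj _] := loc; have [e [s [Zs sl]]] := surj l.
have [|t' Zt'] := loc_ker loc (e := s *: y - r *: e).
  by rewrite (islinearB phil) !(islinearZ phil) yl -sl !scalerA mulrC subrr.
rewrite scalerBr => /subr0_eq; rewrite scalerA => yE.
have Zts := prime_ideal_nmul Zp Zt' Zs.
have [q _ aE] := prime_ideal_dvdr Zp (zero_divisor_mul r0 ar) Zts.
have qr : q * r = 0 by apply: zero_divisorP Zts; rewrite mulrA [_ * q]mulrC -aE.
by rewrite xE aE -scalerA yE !scalerA mulrAC qr mul0r scale0r.
Qed.

(** The duality between [r] and [a] is moved to [w]: take [b = a / c] if [w = c r], and [b = c a] if
    [r = c w]. *)
Lemma ann_loc w : w <> 0 -> exists2 b, w * b = 0 &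
  forall u, u * b = 0 -> exists2 c, ~ Z c & exists d, c * u = d * w.
Proof.
move=> w0; have [[c wE]|[c rE]] := dvdr_total r w.
  have [[a' aE]|[d cE]] := dvdr_total c a; last first.
    by case: w0; rewrite wE cE -mulrA ar mulr0.
  exists a'; first by rewrite wE mulrAC [c * a']mulrC -aE.
  move=> u ua'; have [|c1 Zc1 [d c1u]] := @anna_loc u.
    by rewrite aE mulrA ua' mul0r.
  have [[f dE]|[f cE]] := dvdr_total c d.
    by exists c1 => //; exists f; rewrite c1u dE wE mulrA.
  have Zf : ~ Z f.
    move=> Zf; apply: (amin (y := f) (al := d * a')) => //.
      by rewrite mulrAC -c1u -mulrA ua' mulr0.
    by rewrite aE cE mulrC [d * _]mulrC; ring.
  exists (f * c1); first exact: prime_ideal_nmul Zp _ _ Zf Zc1.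
  by exists 1; rewrite mul1r wE cE -!mulrA c1u.
exists (c * a); first by rewrite mulrA [w * c]mulrC -rE mulrC.
move=> u uca; have [|c1 Zc1 [d]] := @anna_loc (u * c); first by rewrite -mulrA.
rewrite rE => c1u.
exists c1 => //; have [//|[v wE]] := dvdr_total w (c1 * u).
(* A valuation ring is local: either [v d] is a unit, so [w] divides [c1 u], or [1 - v d] is a unit,
   which forces [c c1 u = 0] and then [r = 0]. *)
have [[k kE]|[k kE]] := dvdr_total (v * d) (1 - v * d).
  have vu : (k + 1) * d * v = 1.
    by rewrite -mulrA [d * v]mulrC mulrDl mul1r -kE subrK.
  by exists ((k + 1) * d); rewrite wE mulrA vu mul1r.
have u1 : (k + 1) * (1 - v * d) = 1 by rewrite mulrDl mul1r -kE addrC subrK.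
have cz : c * (c1 * u) = 0.
  rewrite -[LHS]mul1r -u1 -mulrA.
  have -> : (1 - v * d) * (c * (c1 * u)) = c1 * (u * c) - d * (c * (v * (c1 * u))) by ring.
  by rewrite -wE c1u subrr mulr0.
by case: r0; rewrite rE wE mulrCA cz mulr0.
Qed.

(** If [w x = 0], each [u] in [(0 : b)] has a regular multiple in [w R], which kills [x]; without
    regular torsion [u x = 0], so [x] is divisible by [b]. *)
Lemma flat_of_loc_ann_div : flat_module E.
Proof.
apply/flat_moduleP => w x wx.
have [->|/eqP w0] := eqVneq w 0; first by exists 1, x; rewrite mul0r scale1r.
have [b wb bP] := ann_loc w0; exists b.
have [y xE] : exists y, x = b *: y; last by exists y.
apply: Ediv => u /bP[c Zc [d cu]]; apply: (zero_divisors_torsion_free Zc).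
by rewrite scalerA cu -scalerA wx scaler0.
Qed.

End ZeroDivisorsNotFlat.

(** * Assembly of the cases for [J] and [Z] *)

Lemma flat_loc_inj (E L : lmodType R) (phi : E -> L) :
  is_localization Z phi -> flat_module E -> forall e, phi e = 0 -> e = 0.
Proof.
move=> loc /flat_moduleP Eflat e /(loc_ker loc)[t Zt /Eflat[al [y [tal ->]]]].
by rewrite (zero_divisorP tal Zt) scale0r.
Qed.

Lemma uniform_ann_neq (J : R -> Prop) (E L : lmodType R) (phi : E -> L) :
  prime_ideal J -> ~ (forall x, J x <-> Z x) -> is_localization J phi -> uniform_ann J phi.
Proof.
move=> Jp JZ loc.
have [[s Zs Js]|noZ] := pselect (exists2 s, Z s & ~ J s).
  exact: uniform_ann_proper loc _ Zs Js.
have [[s Js Zs]|noJ] := pselect (exists2 s, J s & ~ Z s).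
  exact: uniform_ann_above loc _ Js Zs.
case: JZ => x; split=> [Jx|Zx]; apply: contrapT => n; [apply: noJ | apply: noZ]; by exists x.
Qed.

Lemma uniform_ann_zero_divisors (E L : lmodType R) (phi : E -> L) :
  is_localization Z phi -> flat_module E \/ flat_ideal Z -> uniform_ann Z phi.
Proof.
have Zp := prime_ideal_zero_divisors.
move=> loc [Eflat|/flat_idealP Zflat]; last exact: uniform_ann_flat loc Zflat.
exact/uniform_ann_inj/flat_loc_inj.
Qed.

Lemma flat_of_loc_fp_injective (E L : lmodType R) (phi : E -> L) :
  is_localization Z phi -> fp_injective_module E -> fp_injective_module L ->
  flat_module E \/ flat_ideal Z.
Proof.
move=> loc /fp_injective_ann_div Ediv /fp_injective_ann_div Ldiv.
have [Zflat|nflat] := pselect (flat_ideal Z); [by right | left].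
have [r [a [r0 ar amin]]] : exists r a, [/\ r <> 0, a * r = 0 &
    forall y al, Z y -> al * r = 0 -> a <> y * al].
  apply: contrapT => nra; apply/nflat/flat_idealP => r a r0 ar.
  apply: contrapT => nyal; apply: nra; exists r, a; split=> // y al Zy alr aE.
  by apply: nyal; exists y, al.
exact: (flat_of_loc_ann_div loc Ediv Ldiv r0 ar amin).
Qed.

Lemma loc_fp_injective (J : R -> Prop) (E L : lmodType R) (phi : E -> L) :
  prime_ideal J -> is_localization J phi -> uniform_ann J phi ->
  fp_injective_module E -> fp_injective_module L.
Proof.
move=> Jp loc unif /fp_injective_ann_div Ediv.
exact/ann_div_fp_injective/(loc_ann_div Jp loc Ediv unif).
Qed.

Lemma loc_injective (J : R -> Prop) (E L : lmodType R) (phi : E -> L) :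
  prime_ideal J -> is_localization J phi -> uniform_ann J phi ->
  injective_module E -> injective_module L.
Proof.
move=> Jp loc unif Einj; apply: baer_injective_module.
apply: (loc_baer Jp loc) => //; first exact: injective_module_baer.
exact/(loc_ann_div Jp loc _ unif)/fp_injective_ann_div/injective_module_fp.
Qed.

End ValuationRing.

Theorem mainTheorem2 (R : comNzRingType) (hR : valuation_ring R) (E : lmodType R) :
  (injective_module E ->
     (forall J : R -> Prop, prime_ideal J -> ~ (forall x, J x <-> zero_divisors x) ->
        forall (L : lmodType R) (phi : E -> L), is_localization J phi ->
          injective_module L)
     /\
     (forall (L : lmodType R) (phi : E -> L), is_localization (@zero_divisors R) phi ->
        (injective_module L <-> flat_module E \/ flat_ideal (@zero_divisors R))))
  /\
  (fp_injective_module E ->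
     (forall J : R -> Prop, prime_ideal J -> ~ (forall x, J x <-> zero_divisors x) ->
        forall (L : lmodType R) (phi : E -> L), is_localization J phi ->
          fp_injective_module L)
     /\
     (forall (L : lmodType R) (phi : E -> L), is_localization (@zero_divisors R) phi ->
        (fp_injective_module L <-> flat_module E \/ flat_ideal (@zero_divisors R)))).
Proof.
have Zp := prime_ideal_zero_divisors hR.
split=> [Einj|Efp]; split.
- move=> J Jp JZ L phi loc.
  exact: (loc_injective hR Jp loc (uniform_ann_neq hR Jp JZ loc) Einj).
(* Necessity only needs fp-injectivity of [E] and [L], which injectivity implies. *)
- move=> L phi loc; split=> [/injective_module_fp|flat].
    by apply: (flat_of_loc_fp_injective hR loc); apply: injective_module_fp.
  exact: (loc_injective hR Zp loc (uniform_ann_zero_divisors hR loc flat) Einj).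
- move=> J Jp JZ L phi loc.
  exact: (loc_fp_injective hR Jp loc (uniform_ann_neq hR Jp JZ loc) Efp).
- move=> L phi loc; split=> [|flat]; first exact: (flat_of_loc_fp_injective hR loc).
  exact: (loc_fp_injective hR Zp loc (uniform_ann_zero_divisors hR loc flat) Efp).
Qed.
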